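(* Let $k\ge 2$ and $n\ge 50k^2$ be integers, let $X=\{1,\dots,n\}$, and let $\mathcal F\subset\binom{X}{k}$ be an intersecting family. Then $$|\mathcal I(\mathcal F)|\le |\mathcal I(\mathcal A)|,$$ where $\mathcal A=\left\{A\in\binom{X}{k}\colon |A\cap\{1,2,3\}|\ge 2\right\}$.
   Context: $\binom{X}{k}$ denotes the family of all $k$-element subsets of $X$. A family $\mathcal F$ is intersecting if $F\cap F'\neq\emptyset$ for all $F,F'\in\mathcal F$. For a family $\mathcal F$, $\mathcal I(\mathcal F):=\{F\cap F'\colon F,F'\in\mathcal F,\ F\neq F'\}$ is the family of all distinct pairwise intersections of distinct members. *)

(* Defs.v *)
From mathcomp Require Import all_boot.
Set Implicit Arguments. Unset Strict Implicit. Unset Printing Implicit Defensive.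

(* Ground set X = {1,...,n} is modelled by 'I_n = {0,...,n-1}; element i+1 <-> i. *)

Definition uniform (T : finType) (k : nat) (F : {set {set T}}) : bool :=
  [forall A in F, #|A| == k].

Definition intersecting (T : finType) (F : {set {set T}}) : bool :=
  [forall A in F, forall B in F, A :&: B != set0].

Definition Ifam (T : finType) (F : {set {set T}}) : {set {set T}} :=
  [set A :&: B | A in F, B in F & A != B].

(* {1,2,3} as a subset of 'I_n, i.e. the elements 0,1,2 *)
Definition first3 (n : nat) : {set 'I_n} := [set i : 'I_n | i < 3].

Definition Afam (n k : nat) : {set {set 'I_n}} :=
  [set A : {set 'I_n} | (#|A| == k) && (2 <= #|A :&: first3 n|)].

(* Main.v *)
(* The family [Ifam (Afam n k)] consists of all sets of size less than [k] that
   meet {1,2,3}.  Put g_d = C(n-d, k-1-d), so that 50 k g_(d+1) <= g_d and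
   |Ifam (Afam n k)| >= 3 g_1 - 3 g_2.  Let J be the (k-1)-sets in [Ifam F]; each
   is I = (a + I) & (b + I) with both sets in F.  Two disjoint members of J
   conflict unless one of them contains an extension point of the other.
   Double counting conflicts shows that two points of degree more than
   (2/25) g_1 in J form a cover of F.  If there are three such points, every
   member of F contains two of them, so [Ifam F] consists of small sets
   meeting a fixed 3-set.  Otherwise the members of J avoiding the at most two
   points of large degree number at most (12/25) g_1, so |J| <= (62/25) g_1.
   The (k-2)-sets in [Ifam F] and all the smaller sets contribute only
   a small multiple of g_1. *)

Require Import Defs.
From mathcomp Require Import all_boot.
From mathcomp Require Import zify.
Set Implicit Arguments. Unset Strict Implicit. Unset Printing Implicit Defensive.

(** * Counting by covers and by double counting *)

Lemma card_le_cover (S R : finType) (J : {set S}) (W : {set R})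
    (f : R -> {set S}) (m : nat) :
  (forall A, A \in J -> exists2 w, w \in W & A \in f w) ->
  (forall w, w \in W -> #|f w| <= m) -> #|J| <= #|W| * m.
Proof.
move=> Jf fm; apply: (@leq_trans #|\bigcup_(w in W) f w|).
  by apply/subset_leq_card/subsetP => A /Jf[w Ww Aw]; apply/bigcupP; exists w.
apply: (@leq_trans (\sum_(w in W) #|f w|)).
  elim/big_rec2: _ => [|w U s _ IH]; first by rewrite cards0.
  by rewrite (leq_trans (leq_card_setU _ _)) // leq_add2l.
by rewrite -sum_nat_const; apply: leq_sum.
Qed.

Lemma card_le_setU (S : finType) (J A B : {set S}) :
  (forall x, x \in J -> x \in A \/ x \in B) -> #|J| <= #|A| + #|B|.
Proof.
move=> JAB; apply: leq_trans (leq_card_setU A B).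
by apply/subset_leq_card/subsetP => x /JAB Hx; apply/setUP.
Qed.

(** Each pair is charged to its left member by [R1] or to its right member by [R2]. If [#|B|] is
    positive and at least [2 * x], this yields [#|A| <= 2 * y]. *)
Lemma double_count (S1 S2 : finType) (A : {set S1}) (B : {set S2})
    (R1 R2 : S1 -> S2 -> bool) (x y : nat) :
  (forall u v, u \in A -> v \in B -> R1 u v || R2 u v) ->
  (forall u, u \in A -> #|[set v in B | R1 u v]| <= x) ->
  (forall v, v \in B -> #|[set u in A | R2 u v]| <= y) ->
  #|A| * #|B| <= #|A| * x + #|B| * y.
Proof.
move=> R12 hx hy; rewrite -!sum_nat_const.
apply: (@leq_trans (\sum_(u in A) \sum_(v in B) (R1 u v + R2 u v))).
  apply: leq_sum => u Au; rewrite -sum1_card; apply: leq_sum => v Bv.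
  by have := R12 u v Au Bv; case: (R1 u v); case: (R2 u v).
under eq_bigr do rewrite big_split /=.
rewrite big_split /= leq_add //.
  apply: leq_sum => u Au; apply: leq_trans (hx u Au).
  rewrite -sum1_card -big_mkcondr /= leq_eqVlt; apply/orP; left; apply/eqP.
  by apply: eq_bigl => v; rewrite inE.
rewrite exchange_big /=; apply: leq_sum => v Bv; apply: leq_trans (hy v Bv).
rewrite -sum1_card -big_mkcondr /= leq_eqVlt; apply/orP; left; apply/eqP.
by apply: eq_bigl => u; rewrite inE.
Qed.

(** * Degrees, codegrees and the trivial bound on them *)

Definition above (T : finType) (J : {set {set T}}) (D : {set T}) :=
  [set I in J | D \subset I].

(* The number of [l]-subsets of an [n]-set containing a fixed [d]-subset;
   the test guards against truncated subtraction when [l < d]. *)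
Definition nsup (n l d : nat) := if d <= l then 'C(n - d, l - d) else 0.

Lemma card_above (T : finType) (J : {set {set T}}) (D : {set T}) (l : nat) :
  (forall I, I \in J -> #|I| = l) -> #|above J D| <= nsup #|T| l #|D|.
Proof.
move=> Jl; rewrite /nsup; case: (leqP #|D| l) => [dl|ld]; last first.
  rewrite leqn0 cards_eq0; apply/eqP/setP => I; rewrite !inE.
  apply/andP => -[/Jl Il /subset_leq_card]; lia.
have -> : #|T| - #|D| = #|~: D| by have := cardsC D; lia.
rewrite -(cards_draws (~: D)).
rewrite -(@card_in_imset _ _ (fun I => I :\: D) (above J D)); last first.
  move=> I I'; rewrite !inE => /andP[_ DI] /andP[_ DI'] eqI.
  by rewrite -(setID I D) -(setID I' D) eqI (setIidPr DI) (setIidPr DI').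
apply/subset_leq_card/subsetP => _ /imsetP[I + ->].
rewrite !inE => /andP[/Jl Il DI]; rewrite setDE subsetIr /=.
by rewrite -setDE cardsD (setIidPr DI) Il.
Qed.

(** For [d < k.-1] the quotient of the binomials is [(n - d) / (k.-1 - d)], which [50 * k ^ 2 <= n]
    makes at least [50 * k]. *)
Lemma nsupS (n k d : nat) : 0 < k -> 50 * k ^ 2 <= n ->
  50 * k * nsup n k.-1 d.+1 <= nsup n k.-1 d.
Proof.
move=> k0 nk; rewrite /nsup; case: (ltnP d k.-1) => [dk|_]; last by rewrite muln0.
rewrite (ltnW dk).
have := mul_bin_diag (n - d) (k.-1 - d.+1).
have -> : (n - d).-1 = n - d.+1 by lia.
have -> : (k.-1 - d.+1).+1 = k.-1 - d by lia.
move: ('C(_, _)) ('C(_, _)) => x y E; nia.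
Qed.

Lemma nsup_iter (n k d i : nat) : 0 < k -> 50 * k ^ 2 <= n ->
  (50 * k) ^ i * nsup n k.-1 (d + i) <= nsup n k.-1 d.
Proof.
move=> k0 nk; elim: i => [|i IH]; first by rewrite addn0 expn0 mul1n.
apply: leq_trans IH; rewrite expnSr -mulnA leq_mul2l addnS nsupS //.
by rewrite orbT.
Qed.

Lemma aboveS (T : finType) (J J' : {set {set T}}) (D : {set T}) :
  J' \subset J -> above J' D \subset above J D.
Proof.
by move=> /subsetP sJ; apply/subsetP => I; rewrite !inE => /andP[/sJ-> ->].
Qed.

Lemma meetP (T : finType) (A B : {set T}) :
  reflect (exists2 x, x \in A & x \in B) (A :&: B != set0).
Proof.
apply: (iffP (set0Pn _)) => [[x /setIP[]]|[x Ax Bx]]; first by exists x.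
by exists x; apply/setIP.
Qed.

Lemma card_above_meet (T : finType) (J : {set {set T}}) (D W : {set T})
    (m : nat) :
  (forall z, z \in W -> #|above J (z |: D)| <= m) ->
  #|[set I in above J D | I :&: W != set0]| <= #|W| * m.
Proof.
move=> Jm; apply: (card_le_cover (f := fun z => above J (z |: D))) => // I.
rewrite !inE => /andP[/andP[JI DI]] /meetP[z Iz Wz].
by exists z => //; rewrite !inE JI subUset sub1set Iz.
Qed.

(** * Families of small maximum degree *)

Section Sparse.
Variables (T : finType) (k : nat) (J : {set {set T}}).
Hypotheses (k2 : 1 < k) (nk : 50 * k ^ 2 <= #|T|).
Hypothesis Jk : forall I, I \in J -> #|I| = k.-1.

Let g d := nsup #|T| k.-1 d.
Let sparse := forall p, 25 * #|above J [set p]| <= 2 * g 1.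

(* Were [J] nonempty, growing [D] one point at a time from a point of maximum
   degree [m] would lose a factor at most [2 * k] per step, while the trivial
   bound [g] loses [50 * k]: so [m <= g 1 / 25 ^ j] for as many steps [j] as the
   hypothesis [25 * #|D| * m <= 2 * g 1] allows, and improving [m] allows more
   steps. *)
Lemma sparse_eq0 :
  sparse ->
  (forall (D : {set T}) m y, 0 < #|D| -> (forall p, #|above J [set p]| <= m) ->
     25 * #|D| * m <= 2 * g 1 ->
     (forall z, z \notin D -> #|above J (z |: D)| <= y) ->
     #|above J D| <= 2 * k * y) ->
  J = set0.
Proof.
move=> sp step.
have H j : forall p, 25 * j.+1 * #|above J [set p]| <= 2 * g 1.
  elim: j => [|j IH] p; first by rewrite muln1.
  pose m := \max_q #|above J [set q]|.
  have mP q : #|above J [set q]| <= m by apply: leq_bigmax.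
  have m_le : 25 * j.+1 * m <= 2 * g 1.
    by rewrite /m; elim/big_ind: _ => [|x y|q _] //; rewrite ?muln0 //; lia.
  (* Induction on the number [i] of points still to be added: at size [j.+2] the trivial bound
     applies, and below it [#|D| <= j.+1], so [m_le] permits [step]. *)
  have chain i (D : {set T}) : #|D| + i = j.+2 -> 0 < #|D| ->
      #|above J D| <= (2 * k) ^ i * g j.+2.
    elim: i D => [|i IHi] D Di D0.
      by rewrite expn0 mul1n -Di addn0; apply: card_above.
    rewrite expnS -mulnA; apply: (step D m) => //; first by nia.
    by move=> z zD; apply: IHi; rewrite cardsU1 zD //; lia.
  have c1 := chain j.+1 [set p]; rewrite cards1 in c1.
  have {c1} c1 := c1 erefl erefl.
  have := nsup_iter 1 j.+1 (ltnW k2) nk; rewrite add1n -/(g _) -/(g _) => it.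
  have E : (50 * k) ^ j.+1 = 25 ^ j.+1 * (2 * k) ^ j.+1.
    by rewrite -expnMn; congr (_ ^ _); lia.
  (* Converts the degree bound [g 1 / 25 ^ j.+1] given by the chain into the claim for [j.+1]. *)
  have pw : j.+2 <= 2 * 25 ^ j.
    by elim: (j) => // i; rewrite expnS; lia.
  have e25 : 25 ^ j.+1 * #|above J [set p]| <= g 1.
    apply: leq_trans it; rewrite E -mulnA.
    by rewrite leq_mul2l c1 orbT.
  rewrite expnS in e25; have := leq_mul pw (leqnn #|above J [set p]|).
  move: e25; move: (25 ^ j) #|_| (g 1) => x f G; clear; nia.
apply/eqP; apply/set0Pn => -[I JI].
have /card_gt0P [p Ip] : 0 < #|I| by rewrite Jk //; lia.
(* At [j = g 1] the factor exceeds the right-hand side, so every degree vanishes. *)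
have Hp := H (g 1) p.
have : 0 < #|above J [set p]|.
  by apply/card_gt0P; exists I; rewrite !inE JI sub1set.
move: Hp; move: #|_| (g 1) => f G; clear; nia.
Qed.

(** In a larger family some member [I1] avoids [D], since few members meet [D]. All members
    containing [D] meet [I1], necessarily outside [D], so one of fewer than [2 * k] points can be
    added to [D]. *)
Lemma sparse_intersecting : sparse -> intersecting J ->
  25 * #|J| <= 2 * g 1.
Proof.
move=> sp Jint; rewrite leqNgt; apply/negP => Jbig.
suff J0 : J = set0 by rewrite J0 cards0 in Jbig.
apply: sparse_eq0 => // D m y D0 mP Dm hy.
have : ~~ (J \subset [set I in above J set0 | I :&: D != set0]).
  apply/negP => /subset_leq_card; rewrite leqNgt => /negP[].
  apply: leq_ltn_trans (_ : #|D| * m < _); last by lia.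
  by apply: card_above_meet => z _; rewrite setU0.
case/subsetPn => I1 J1; rewrite !inE J1 sub0set /= negbK => /eqP I1D.
apply: (@leq_trans (#|I1| * y)); last by rewrite (Jk J1) leq_mul2r; lia.
apply: leq_trans (_ : #|[set I in above J D | I :&: I1 != set0]| <= _).
  apply/subset_leq_card/subsetP => I JI; rewrite inE JI /=.
  have := JI; rewrite inE => /andP[JI' _].
  by move/forall_inP: Jint => /(_ I JI')/forall_inP/(_ I1 J1).
apply: card_above_meet => z I1z; apply: hy.
by apply: contra_eqN I1D => Dz; apply/set0Pn; exists z; rewrite inE I1z.
Qed.
End Sparse.

(** * Conflicts between intersections of size [k.-1] *)

Section Conflict.
Variables (T : finType) (k : nat) (F J : {set {set T}}) (a b : {set T} -> T).
Hypotheses (k2 : 1 < k) (nk : 50 * k ^ 2 <= #|T|).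
Hypotheses (Fk : uniform k F) (Fint : intersecting F).
Hypothesis Jab : forall I, I \in J ->
  [/\ #|I| = k.-1, a I != b I, a I |: I \in F & b I |: I \in F].

Let g d := nsup #|T| k.-1 d.

Lemma family_meet A B : A \in F -> B \in F -> exists2 x, x \in A & x \in B.
Proof.
move=> FA FB; apply/meetP.
by move/forall_inP: Fint => /(_ A FA)/forall_inP/(_ B FB).
Qed.

Lemma family_card A : A \in F -> #|A| = k.
Proof. by move=> FA; apply/eqP; move/forall_inP: Fk; apply. Qed.

Let Jk I : I \in J -> #|I| = k.-1.
Proof. by case/Jab. Qed.

(* If neither holds, [a I |: I] and [b I |: I] can meet [c |: I'] only in [c],
   so [a I = c = b I]. *)
Lemma conflict I I' c : I \in J -> c |: I' \in F ->
  (I' :&: [set a I; b I] != set0) || (I :&: (c |: I') != set0).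
Proof.
case/Jab=> _ ab FaI FbI FcI; rewrite -negb_and; apply/negP => /andP[/eqP E1 /eqP E2].
have H x : x |: I \in F -> x \in [set a I; b I] -> x = c.
  move=> FxI xab; have [y] := family_meet FxI FcI.
  rewrite !inE => /orP[/eqP-> | yI] /orP[/eqP | ] //.
  - by move=> xI'; have := in_set0 x; rewrite -E1 inE xI' xab.
  - by move=> yc; have := in_set0 y; rewrite -E2 !inE yI yc eqxx.
  - by move=> yI'; have := in_set0 y; rewrite -E2 !inE yI yI' orbT.
by have := ab; rewrite (H _ FaI (set21 _ _)) (H _ FbI (set22 _ _)) eqxx.
Qed.

(** With [q] neither in [I] nor extending it, and symmetrically, a conflict between members of
    [only p q] and [only q p] puts a second prescribed point into one of them, so it is counted by
    [g 2]. *)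
Let only p q := [set I in above J [set p] | (q \notin I) && (q \notin [set a I; b I])].

Let card_above_pair p z : z != p -> #|above J (z |: [set p])| <= g 2.
Proof.
move=> zp; have := card_above (z |: [set p]) Jk.
by rewrite cardsU1 cards1 inE zp.
Qed.

Let card_only_mul p q :
  #|only p q| * #|only q p| <= #|only p q| * (2 * g 2) + #|only q p| * (k * g 2).
Proof.
apply: (double_count (R1 := fun I I' => I' :&: [set a I; b I] != set0)
                     (R2 := fun I I' => I :&: (a I' |: I') != set0)).
- move=> I I'; rewrite !inE => /andP[/andP[JI _] _] /andP[/andP[JI' _] _].
  by apply: conflict => //; case/Jab: JI'.
- move=> I; rewrite inE => /andP[_ /andP[_ qab]].
  apply: (@leq_trans (#|[set a I; b I]| * g 2)); last first.
    by rewrite leq_mul // cards2; case: (_ != _).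
  apply: leq_trans (card_above_meet (J := J) (D := [set q]) _).
    apply/subset_leq_card/subsetP => I' /setIdP[].
    by case/setIdP=> qI' _ HI'; apply/setIdP.
  by move=> z zab; apply: card_above_pair; apply: contraNneq qab => <-.
- move=> I'; rewrite inE => /andP[+ /andP[pI' pab]].
  rewrite inE => /andP[/Jab[_ _ FaI _] _].
  rewrite -(family_card FaI).
  apply: leq_trans (card_above_meet (J := J) (D := [set p]) _).
    apply/subset_leq_card/subsetP => I /setIdP[].
    by case/setIdP=> pI _ HI; apply/setIdP.
  move=> z zab; apply: card_above_pair; apply: contraTneq zab => ->.
  by move: pab; rewrite !inE !negb_or pI' andbT => /andP[].
Qed.

(** If [q] extends a member [I] through [p], then [q |: I] meets [G] outside [q], so [I] meets [G]
    in a point other than [p]. *)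
Let card_above_only p q G : p != q -> G \in F -> p \notin G -> q \notin G ->
  #|above J [set p]| <= #|only p q| + (g 2 + k * g 2).
Proof.
move=> pq FG pG qG.
pose M := [set I in above J [set p] | I :&: G != set0].
apply: (@leq_trans (#|only p q| + #|above J (q |: [set p]) :|: M|)).
  apply: card_le_setU => I HI.
  case: (boolP (q \in I)) => qI.
    right; apply/setUP; left; move: HI; rewrite !inE => /andP[-> pI].
    by rewrite subUset pI sub1set qI.
  case: (boolP (q \in [set a I; b I])) => qab; last first.
    by left; apply/setIdP; rewrite qI qab.
  right; apply/setUP; right; apply/setIdP; split=> //.
  have FqI : q |: I \in F.
    move: HI; rewrite inE => /andP[/Jab[_ _ FaI FbI] _].
    by move: qab; rewrite !inE => /orP[]/eqP->.
  have [x] := family_meet FqI FG.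
  rewrite !inE => /orP[/eqP-> /idPn// | xI xG].
  by apply/meetP; exists x.
rewrite leq_add2l (leq_trans (leq_card_setU _ _)) // leq_add //.
  by apply: card_above_pair; rewrite eq_sym.
rewrite -(family_card FG); apply: card_above_meet => z Gz.
by apply: card_above_pair; apply: contraNneq pG => <-.
Qed.

(** Used in contrapositive: two points of larger degree form a cover of [F], since no [G] can avoid
    both. *)
Lemma degree_dichotomy p q G : p != q -> G \in F -> p \notin G -> q \notin G ->
  #|above J [set p]| <= 4 * k * g 2 \/ #|above J [set q]| <= 4 * k * g 2.
Proof.
move=> pq FG pG qG.
have Dp := card_above_only pq FG pG qG.
have Dq : #|above J [set q]| <= _ := card_above_only _ FG qG pG.
rewrite eq_sym in Dq; move/(_ pq) in Dq.
have := card_only_mul p q; clear nk.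
(* If both sizes exceed [k.+2 * g 2], the product inequality fails. Otherwise one degree is at most
   [(2 * k + 3) * g 2], within [4 * k * g 2] as [k >= 2]. *)
case: (leqP #|only p q| (k.+2 * g 2)) => [le _|Hp]; first by left; nia.
case: (leqP #|only q p| (k.+2 * g 2)) => [le _|Hq]; first by right; nia.
by move: Hp Hq k2; clear; move: #|_| #|_| (g 2) => x y z; nia.
Qed.

(** Members containing [D] conflict with members avoiding [D]. Conflicts at extension points of the
    former are limited by the degree bound [m]; all others supply a point to add to [D]. *)
Lemma sparse_conflicting :
  (forall p, 25 * #|above J [set p]| <= 2 * g 1) -> 25 * #|J| <= 12 * g 1.
Proof.
move=> sp; rewrite leqNgt; apply/negP => Jbig.
suff J0 : J = set0 by rewrite J0 cards0 in Jbig.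
apply: (sparse_eq0 (k := k)) => // D m y D0 mP; rewrite -/(g 1) => Dm hy.
(* Members disjoint from [D] with both extension points in [D] give no
   information on [above J D], but they form an intersecting family. *)
pose E := [set I in J | (I :&: D == set0) && ([set a I; b I] \subset D)].
have sEJ : E \subset J by apply/subsetP => I /setIdP[].
have Eint : intersecting E.
  apply/forall_inP => I; rewrite inE => /and3P[JI /eqP ID abD].
  apply/forall_inP => I'; rewrite inE => /and3P[JI' /eqP ID' abD'].
  have notin L x : L :&: D = set0 -> x \in L -> x \in D -> false.
    by move=> LD xL xD; rewrite -(in_set0 x) -LD inE xL.
  (* The extension points lie in [D], which [I] and [I'] avoid, so extensions by different points
     can only meet inside [I :&: I']. One of the two extension points of [I'] differs from [a I]. *)
  have meet c : c \in [set a I'; b I'] -> c != a I -> c |: I' \in F -> I :&: I' != set0.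
    move=> cab ca FcI; have [_ _ FaI _] := Jab JI.
    have aD : a I \in D by apply: (subsetP abD); rewrite !inE eqxx.
    have cD : c \in D by apply: (subsetP abD').
    have [x] := family_meet FaI FcI; rewrite !inE => /orP[/eqP-> | xI] /orP[|xI'].
    - by rewrite eq_sym (negPf ca).
    - by have := notin _ _ ID' xI' aD.
    - by move/eqP=> xc; rewrite -xc in cD; have := notin _ _ ID xI cD.
    - by apply/meetP; exists x.
  have [_ ab FaI FbI] := Jab JI'.
  case: (eqVneq (a I') (a I)) => [E1|ca]; last by apply: meet ca _; rewrite ?inE ?eqxx.
  by apply: (meet (b I')); rewrite ?inE ?eqxx ?orbT // -E1 eq_sym.
have E_le : 25 * #|E| <= 2 * g 1.
  apply: sparse_intersecting => //; first by move=> I /(subsetP sEJ)/Jk.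
  move=> p; apply: leq_trans (sp p).
  by rewrite leq_mul2l subset_leq_card ?orbT // aboveS.
pose B := [set I in J | (I :&: D == set0) && ~~ ([set a I; b I] \subset D)].
(* Of more than [12/25 * g 1] members, at most [2/25 * g 1] meet [D] and as many lie in [E]. The
   remaining [8/25 * g 1] is at least [4 * m]. *)
have B_ge : 4 * m <= #|B|.
  have : #|J| <= #|[set I in above J set0 | I :&: D != set0]| + #|E :|: B|.
    apply: card_le_setU => I JI; rewrite !inE JI sub0set /=.
    case: (I :&: D == set0) => /=; [right | by left].
    by case: (_ \subset _).
  have [+ _] := leq_card_setU E B.
  have : #|[set I in above J set0 | I :&: D != set0]| <= #|D| * m.
    by apply: card_above_meet => z _; rewrite setU0.
  have dm : m <= #|D| * m by rewrite leq_pmull.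
  by rewrite -mulnA in Dm; move: E_le Dm dm Jbig; clear; move: (g 1) (#|D| * m); lia.
have : #|above J D| * #|B| <= #|above J D| * (2 * m) + #|B| * (k * y).
  (* For a member of [B] this extension point lies outside [D], so its extension avoids [D] and [hy]
     applies at each of the [k] points. *)
  pose c I := if a I \in D then b I else a I.
  apply: (double_count (R1 := fun I I' => I' :&: [set a I; b I] != set0)
                       (R2 := fun I I' => I :&: (c I' |: I') != set0)).
  - move=> I I'; rewrite !inE => /andP[JI _] /andP[/Jab[_ _ FaI FbI] _].
    by apply: conflict => //; rewrite /c; case: ifP.
  - move=> I _; apply: (@leq_trans (#|[set a I; b I]| * m)); last first.
      by rewrite leq_mul // cards2; case: (_ != _).
    apply: leq_trans (card_above_meet (J := J) (D := set0) _).
      apply/subset_leq_card/subsetP => I' /setIdP[].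
      by case/setIdP=> JI' _ HI'; rewrite !inE JI' sub0set.
    by move=> z _; rewrite setU0.
  - move=> I'; rewrite inE => /and3P[/Jab[_ _ FaI FbI] /eqP ID abD].
    have FcI : c I' |: I' \in F by rewrite /c; case: ifP.
    rewrite -(family_card FcI); apply: card_above_meet => z zc; apply: hy.
    apply/negP => zD; move: zc; rewrite in_setU1 => /orP[/eqP zc | zI].
      move: abD zD; rewrite zc /c subUset !sub1set.
      by case: ifP => aD /=; [move/negP | rewrite aD].
    by have := in_set0 z; rewrite -ID inE zI zD.
have B0 : 0 < #|B|.
  case: (posnP m) => [m0|]; last by lia.
  have J0 : #|J| <= 0.
    have [->|[I JI]] := set_0Vmem J; first by rewrite cards0.
    have /card_gt0P [p Ip] : 0 < #|I| by rewrite Jk //; lia.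
    have := mP p; rewrite m0 leqn0 cards_eq0 => /eqP/setP/(_ I).
    by rewrite !inE JI sub1set Ip.
  by move: J0 Jbig; clear; lia.
by move: B_ge B0; clear; move: #|_| #|_| => x z; nia.
Qed.
End Conflict.

(** * Intersections whose petals have two points *)

Section PairConflict.
Variables (T : finType) (F K : {set {set T}}) (P Q : {set T} -> {set T}).
Variables (l h : nat).
Hypothesis Fint : intersecting F.
Hypothesis KPQ : forall I, I \in K ->
  [/\ #|I| = l, #|P I| = 2, #|Q I| = 2, P I :&: Q I = set0 &
      P I :|: I \in F /\ Q I :|: I \in F].
Hypothesis Kh : forall p, #|above K [set p]| <= h.

Let card_meet W : #|[set I in K | I :&: W != set0]| <= #|W| * h.
Proof.
apply: leq_trans (card_above_meet (J := K) (D := set0) _).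
  by apply/subset_leq_card/subsetP => I /setIdP[KI HI]; rewrite !inE KI sub0set.
by move=> z _; rewrite setU0.
Qed.

Let core I := P I :|: Q I.

Let card_core I : I \in K -> #|core I| <= 4.
Proof.
by case/KPQ=> _ P2 Q2 _ _; have [+ _] := leq_card_setU (P I) (Q I); rewrite P2 Q2.
Qed.

(** Averaging: each core has at most four points, so at most [4 * h] members meet it; hence some
    member is met by at most [4 * h] cores. *)
Lemma exists_typical : K != set0 ->
  exists2 I1, I1 \in K & #|[set I in K | I1 :&: core I != set0]| <= 4 * h.
Proof.
case/set0Pn=> I0 KI0; apply/exists_inP; apply: contraT; rewrite negb_exists_in.
move=> /forall_inP H.
(* A small [K] is treated apart because the subtraction below truncates. *)
have K_le : #|K| <= 4 * h -> false.
  move=> K4; move/negP: (H I0 KI0); case; apply: leq_trans K4.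
  by apply/subset_leq_card/subsetP => I /setIdP[].
have : #|K| * #|K| <= #|K| * (#|K| - (4 * h).+1) + #|K| * (4 * h).
  apply: (double_count (R1 := fun u v => u :&: core v == set0)
                       (R2 := fun u v => u :&: core v != set0)).
  - by move=> u v _ _; case: eqP.
  - move=> u Ku; have := H u Ku; rewrite -ltnNge => Hu.
    have := cardsID [set v in K | u :&: core v != set0] K.
    have -> : K :&: [set v in K | u :&: core v != set0] = [set v in K | u :&: core v != set0].
      by apply/setP => v; rewrite !inE; case: (v \in K).
    have -> : K :\: [set v in K | u :&: core v != set0] = [set v in K | u :&: core v == set0].
      by apply/setP => v; rewrite !inE; case: (v \in K); rewrite ?andbF //= negbK andbT.
    by move=> <-; rewrite addnC -addnBA // leq_addr.
  - by move=> v Kv; apply: leq_trans (card_meet _) _; rewrite leq_mul2r card_core ?orbT.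
have : 0 < #|K| by apply/card_gt0P; exists I0.
by move=> K0 HK; apply: K_le; nia.
Qed.

(** Relative to a typical [I1], at most [(l + 4) * h] members meet [core I1 :|: I1], at most [4 * h]
    have a core meeting [I1], and the rest, [K1], number at most [4 * (l * h)]. *)
Lemma card_pair_conflict : #|K| <= (5 * l + 8) * h.
Proof.
have [->|K0] := eqVneq K set0; first by rewrite cards0.
have [I1 KI1 typ] := exists_typical K0.
have [I1l P2 Q2 PQ1 [FP1 FQ1]] := KPQ KI1.
pose K1 := [set I in K | (I :&: (core I1 :|: I1) == set0) && (I1 :&: core I == set0)].
have meet A B C D : A :|: B \in F -> C :|: D \in F -> B :&: D = set0 ->
    B :&: C = set0 -> D :&: A = set0 -> exists2 x, x \in A & x \in C.
  move=> FAB FCD BD BC DA.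
  have /meetP[x] : (A :|: B) :&: (C :|: D) != set0.
    by move/forall_inP: Fint => /(_ _ FAB)/forall_inP/(_ _ FCD).
  move=> /setUP[xA|xB] /setUP[xC|xD]; first by exists x.
  - by have := in_set0 x; rewrite -DA inE xA xD.
  - by have := in_set0 x; rewrite -BC inE xB xC.
  - by have := in_set0 x; rewrite -BD inE xB xD.
have K1P I : I \in K1 -> [/\ I \in K, I :&: I1 = set0, I :&: core I1 = set0 & I1 :&: core I = set0].
  rewrite inE setIUr setU_eq0 => /and3P[KI /andP[/eqP ? /eqP ?] /eqP ?].
  by split.
(* [P I] and [Q I] meet the disjoint pairs [P I1] and [Q I1], hence are
   transversals of them: [P I] takes only four values, and members of [K1]
   sharing [P I] meet each other. *)
have pairP I (A : {set T}) : I \in K1 -> A :|: I \in F -> A \subset core I -> #|A| = 2 ->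
    exists2 w, w \in setX (P I1) (Q I1) & A = [set w.1; w.2].
  move=> K1I FA sA A2; have [KI II1 IW I1W] := K1P I K1I.
  have I1A : I1 :&: A = set0.
    by apply/eqP; rewrite -subset0 -I1W setIS.
  have [c Ac Pc] : exists2 x, x \in A & x \in P I1.
    apply: meet FA FP1 II1 _ I1A; apply/eqP.
    by rewrite -subset0 -IW setIS // subsetUl.
  have [d Ad Qd] : exists2 x, x \in A & x \in Q I1.
    apply: meet FA FQ1 II1 _ I1A; apply/eqP.
    by rewrite -subset0 -IW setIS // subsetUr.
  exists (c, d); first by rewrite inE Pc Qd.
  apply/eqP; rewrite eq_sym eqEcard subUset !sub1set Ac Ad A2 cards2 /=.
  have -> // : c != d.
  by apply/eqP => cd; have := in_set0 c; rewrite -PQ1 inE Pc cd Qd.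
have K1_le : #|K1| <= #|setX (P I1) (Q I1)| * (l * h).
  apply: (card_le_cover (f := fun w => [set I in K1 | P I == [set w.1; w.2]])).
    move=> I K1I; have [KI _ _ _] := K1P I K1I.
    have [_ PI2 _ _ [FPI _]] := KPQ KI.
    have [w Ww Pw] := pairP I (P I) K1I FPI (subsetUl _ _) PI2.
    by exists w => //; rewrite inE K1I Pw eqxx.
  move=> w Ww; have [->|[I0]] := set_0Vmem [set I in K1 | P I == [set w.1; w.2]].
    by rewrite cards0.
  move=> /setIdP[K1I0 /eqP PI0]; have [KI0 _ I0W _] := K1P I0 K1I0.
  have [I0l _ Q02 PQ0 [FP0 FQ0]] := KPQ KI0.
  rewrite -I0l; apply: leq_trans (card_meet I0).
  apply/subset_leq_card/subsetP => I /setIdP[K1I /eqP PI].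
  have [KI _ IW _] := K1P I K1I; apply/setIdP; split=> //.
  have [_ _ _ _ [FPI _]] := KPQ KI.
  have sub (A B : {set T}) : B \subset core I1 -> A :&: core I1 = set0 -> A :&: B = set0.
    by move=> sB AW; apply/eqP; rewrite -subset0 -AW setIS.
  (* Both pairs lie in [core I1], which [I] and [I0] avoid. Were [I] and [I0] disjoint, [P I = P I0]
     would have to meet [Q I0]. *)
  apply/negP => /eqP II0.
  have [x] : exists2 x, x \in P I & x \in Q I0.
    apply: (meet _ _ _ _ FPI FQ0 II0); apply: sub => //.
      have [v] := pairP I0 (Q I0) K1I0 FQ0 (subsetUr _ _) Q02.
      rewrite inE => /andP[v1 v2] ->.
      by rewrite subUset !sub1set !inE v1 v2 orbT.
    move: Ww; rewrite PI inE => /andP[w1 w2].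
    by rewrite subUset !sub1set !inE w1 w2 orbT.
  by rewrite PI -PI0 => xP xQ; have := in_set0 x; rewrite -PQ0 inE xP xQ.
have : #|K| <= #|[set I in K | I :&: (core I1 :|: I1) != set0]|
             + #|[set I in K | I1 :&: core I != set0] :|: K1|.
  apply: card_le_setU => I KI; rewrite !inE KI /=.
  case: eqP => _ /=; [right | by left].
  by case: eqP => _.
have [+ _] := leq_card_setU [set I in K | I1 :&: core I != set0] K1.
have := card_meet (core I1 :|: I1).
have [+ _] := leq_card_setU (core I1) I1.
have := card_core KI1; rewrite I1l.
move: K1_le typ; rewrite cardsX P2 Q2; clear; nia.
Qed.
End PairConflict.

(** * Pairwise intersections and their petals *)

Lemma IfamP (T : finType) (F : {set {set T}}) (I : {set T}) :
  reflect (exists A B, [/\ A \in F, B \in F, A != B & I = A :&: B]) (I \in Ifam F).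
Proof.
apply: (iffP imset2P) => [[A B FA]|[A [B [FA FB AB ->]]]].
  by rewrite inE => /andP[FB AB] ->; exists A, B.
by exists A B; rewrite // inE FB.
Qed.

Lemma card_Ifam_lt (T : finType) (F : {set {set T}}) (k : nat) (I : {set T}) :
  uniform k F -> I \in Ifam F -> #|I| < k.
Proof.
move=> /forall_inP Fk /IfamP[A [B [/Fk/eqP Ak /Fk/eqP Bk AB ->]]].
rewrite -Ak; apply: proper_card; rewrite properE subsetIl.
apply: contra AB => /subsetIP[_ sAB].
by rewrite eqEcard sAB Ak Bk /=.
Qed.

Lemma Ifam_petals (T : finType) (F : {set {set T}}) (k : nat) :
  uniform k F -> exists P Q : {set T} -> {set T}, forall I, I \in Ifam F ->
  [/\ #|P I| = k - #|I|, #|Q I| = k - #|I|, P I :&: Q I = set0,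
      P I :|: I \in F & Q I :|: I \in F].
Proof.
move=> /forall_inP Fk.
(* Fixes one representation of each intersection; the default [(I, I)] is never taken for [I] in
   [Ifam F]. *)
pose w (I : {set T}) := odflt (I, I) [pick v in setX F F | (v.1 != v.2) && (I == v.1 :&: v.2)].
exists (fun I => (w I).1 :\: I), (fun I => (w I).2 :\: I) => I /IfamP[A [B [FA FB AB IAB]]].
rewrite /w; case: pickP => /= [[{A B FA FB AB IAB}A B] | /(_ (A, B))]; last first.
  by rewrite /= !inE /= FA FB AB IAB eqxx.
rewrite !inE /= => /andP[/andP[FA FB] /andP[_ /eqP->]].
have [/eqP Ak /eqP Bk] := (Fk A FA, Fk B FB).
rewrite !cardsD Ak Bk (setIA A A B) setIid (setIC A B) (setIA B B A) setIid.
split=> //.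
- by apply/setP => x; rewrite !inE; case: (x \in A); case: (x \in B).
- rewrite (_ : _ :|: _ = A) //.
  by apply/setP => x; rewrite !inE; case: (x \in A); case: (x \in B).
- rewrite (_ : _ :|: _ = B) //.
  by apply/setP => x; rewrite !inE; case: (x \in A); case: (x \in B).
Qed.

(** * Sets meeting a fixed set, and binomial estimates *)

Definition hits (T : finType) (S : {set T}) (k : nat) : {set {set T}} :=
  [set I : {set T} | (#|I| < k) && (I :&: S != set0)].

Lemma card_small_subsets (T : finType) (B : {set T}) (m : nat) :
  #|[set A : {set T} | (A \subset B) && (#|A| < m)]| = \sum_(j < m) 'C(#|B|, j).
Proof.
elim: m => [|m IH].
  by rewrite big_ord0; apply: eq_card0 => A; rewrite !inE ltn0 andbF.
rewrite big_ord_recr /= -IH -cards_draws -cardsUI.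
rewrite [_ :&: _](_ : _ = set0) ?cards0 ?addn0; last first.
  by apply/setP => A; rewrite !inE; case: ltngtP; rewrite ?andbF.
by apply: eq_card => A; rewrite !inE ltnS leq_eqVlt orbC andb_orr.
Qed.

(** Complementary counting. The additive form also shows that the count depends only on [#|S|], so
    any two 3-sets can be compared. *)
Lemma card_hits (T : finType) (S : {set T}) (k : nat) :
  #|hits S k| + \sum_(j < k) 'C(#|T| - #|S|, j) = \sum_(j < k) 'C(#|T|, j).
Proof.
have -> : #|T| - #|S| = #|~: S| by have := cardsC S; lia.
rewrite -cardsT -!card_small_subsets addnC.
pose U := [set A : {set T} | (A \subset setT) && (#|A| < k)].
rewrite -(cardsID [set A : {set T} | A \subset ~: S] U).
congr (_ + _); apply: eq_card => A; rewrite !inE subsetT /=.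
  by rewrite andbC.
by rewrite -disjoints_subset setI_eq0 andbC.
Qed.

(** Only sets of size [k.-1] are kept. With [n = #|T|], Pascal's rule counts them as
    [C(n-1,k-2) + C(n-2,k-2) + C(n-3,k-2)], with terms at least [g_1], [g_1 - g_2] and
    [g_1 - 2 g_2]. *)
Lemma card_hits_ge (T : finType) (S : {set T}) (k : nat) : 1 < k -> k < #|T| -> 2 < #|T| ->
  #|S| = 3 -> 3 * nsup #|T| k.-1 1 <= #|hits S k| + 3 * nsup #|T| k.-1 2.
Proof.
move=> k2 kT T2 S3; have := card_hits S k; rewrite S3.
case: k k2 kT => [|[|k]] // _ kT.
rewrite !(big_ord_recr k.+1) /=.
have : \sum_(j < k.+1) 'C(#|T| - 3, j) <= \sum_(j < k.+1) 'C(#|T|, j).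
  by apply: leq_sum => j _; apply: leq_bin2l; lia.
case: #|T| T2 => [|[|[|N]]] // _; rewrite /nsup /= !subSS !subn0.
case: k kT => [|k] _; first by rewrite !bin0 !bin1 /=; lia.
rewrite /= !subSS !subn0.
have := leq_bin2l k (leqnSn N).
rewrite !binS; lia.
Qed.

Lemma bin_double (n j : nat) : 3 * j + 2 <= n -> 2 * 'C(n, j) <= 'C(n, j.+1).
Proof.
move=> jn; have := mul_bin_left n j; move: 'C(_, _) 'C(_, _) => x y.
by nia.
Qed.

(** In this range consecutive binomials at least double, so each dominates the sum of its
    predecessors. *)
Lemma sum_bin_le (n m : nat) : 3 * m <= n -> \sum_(j < m) 'C(n, j) <= 'C(n, m).
Proof.
elim: m => [|m IH] mn; first by rewrite big_ord0.
rewrite big_ord_recr /=; have {}IH : \sum_(j < m) 'C(n, j) <= 'C(n, m) by apply: IH; lia.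
apply: leq_trans (_ : _ <= 2 * 'C(n, m)) (bin_double _); last by lia.
by rewrite mul2n -addnn leq_add2r.
Qed.

Lemma nsup_pred (n k : nat) : 1 < k -> 50 * k ^ 2 <= n ->
  50 * k * nsup n k.-2 1 <= nsup n k.-1 1.
Proof.
case: k => [|[|[|k]]] // _ nk; rewrite /nsup /= ?muln0 // !subSS !subn0; have := mul_bin_left (n - 1) k.
by move: 'C(_, _) 'C(_, _) => x y; nia.
Qed.

(** One factor 2 absorbs all sizes below [k - 3], the other passes from [C(n, k-3)] to
    [C(n-1, k-3)]. *)
Lemma card_small_sets (T : finType) (k : nat) : 1 < k -> 50 * k ^ 2 <= #|T| ->
  #|[set A : {set T} | #|A| < k.-2]| <= 4 * nsup #|T| k.-2 1.
Proof.
move=> k2 nk; rewrite -(eq_card (A := [set A : {set T} | (A \subset setT) && (#|A| < k.-2)])).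
  rewrite card_small_subsets cardsT.
  case: k k2 nk => [|[|[|k]]] // _ nk; first by rewrite big_ord0.
  rewrite /nsup /= subSS subn0 big_ord_recr /=.
  have s : \sum_(i < k) 'C(#|T|, i) <= 'C(#|T|, k) by apply: sum_bin_le; lia.
  have : 'C(#|T|, k) <= 2 * 'C(#|T| - 1, k).
    case: k nk {s} => [|k] nk; first by rewrite !bin0.
    case: #|T| nk => [|N] nk; first by lia.
    rewrite binS subSS subn0; have : 3 * k + 2 <= N by lia.
    by move/bin_double; clear; lia.
  by move: s; move: (\sum_(i < k) _) 'C(_, _) 'C(_, _) => x y z; clear; lia.
by move=> A; rewrite !inE subsetT.
Qed.

Lemma exists_subset (T : finType) (U : {set T}) (m : nat) : m <= #|U| ->
  exists2 X : {set T}, X \subset U & #|X| = m.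
Proof.
rewrite -bin_gt0 -cards_draws => /card_gt0P[X].
by rewrite inE => /andP[XU /eqP Xm]; exists X.
Qed.

(** * Lower bound: the intersections realized by [Afam] *)

Lemma card_first3 (n : nat) : 2 < n -> #|first3 n| = 3.
Proof.
move=> n2; have winj : injective (widen_ord n2).
  by move=> x y /(congr1 val) /= /val_inj.
rewrite -[RHS](card_ord 3) -(card_imset _ winj).
apply: eq_card => i; rewrite inE; apply/idP/imsetP => [i3|[j _ ->]].
  by exists (Ordinal i3) => //; apply: val_inj.
exact: ltn_ord j.
Qed.

(** Two disjoint petals are attached to [I]. They avoid [S] if [I] has two points there; if it has
    one, each petal receives a different one of the other two points of [S]. *)
Lemma hits_sub_Ifam (n k : nat) : 1 < k -> 50 * k ^ 2 <= n ->
  hits (first3 n) k \subset Ifam (Afam n k).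
Proof.
move=> k2 nk; set S := first3 n; apply/subsetP => I; rewrite inE => /andP[Ik IS0].
have S3 : #|S| = 3 by apply: card_first3; nia.
suff [X [Y [XI YI XY [Xk Yk] [XS YS]]]] : exists X Y : {set 'I_n},
    [/\ X :&: I = set0, Y :&: I = set0, X :&: Y = set0,
        #|X| = k - #|I| /\ #|Y| = k - #|I| &
        1 < #|(X :|: I) :&: S| /\ 1 < #|(Y :|: I) :&: S|].
  have cardU (Z : {set 'I_n}) : Z :&: I = set0 -> #|Z| = k - #|I| -> #|Z :|: I| = k.
    by move=> ZI Zk; rewrite cardsU ZI cards0 Zk; lia.
  apply/IfamP; exists (X :|: I), (Y :|: I); split.
  - by rewrite inE cardU // eqxx.
  - by rewrite inE cardU // eqxx.
  - apply/negP => /eqP eqXY; have /card_gt0P [x Xx] : 0 < #|X| by rewrite Xk; lia.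
    have := in_set0 x; have : x \in Y :|: I by rewrite -eqXY inE Xx.
    by rewrite inE => /orP[] xZ; [rewrite -XY | rewrite -XI]; rewrite inE Xx xZ.
  - by rewrite -setUIl XY set0U.
have far m (Z : {set 'I_n}) : m <= k -> #|Z| <= k ->
    exists2 X : {set 'I_n}, [disjoint X & I :|: S :|: Z] & #|X| = m.
  move=> mk Zk; have [|X XU Xm] := @exists_subset _ (~: (I :|: S :|: Z)) m.
    have := cardsC (I :|: S :|: Z); rewrite card_ord.
    have [+ _] := leq_card_setU (I :|: S) Z; have [+ _] := leq_card_setU I S.
    by nia.
  by exists X => //; rewrite disjoints_subset.
have disj (X Z W : {set 'I_n}) : [disjoint X & Z] -> W \subset Z -> X :&: W = set0.
  by move=> XZ WZ; apply/eqP; rewrite setI_eq0; apply: disjointWr XZ.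
have sI Z : I \subset I :|: S :|: Z by rewrite -setUA subsetUl.
have sS Z : S \subset I :|: S :|: Z by rewrite setUAC subsetUr.
have [IS2 | IS1] := ltnP 1 #|I :&: S|.
  have [|| X0 dX X0k] := far (k - #|I|) set0; rewrite ?cards0 ?leq_subr //.
  have [|| Y0 dY Y0k] := far (k - #|I|) X0; rewrite ?X0k ?leq_subr //.
  exists X0, Y0; split=> //.
  - exact: disj dX (sI _).
  - exact: disj dY (sI _).
  - by rewrite setIC; apply: disj dY (subsetUr _ _).
  - by split; apply: leq_trans IS2 _; rewrite subset_leq_card // setSI // subsetUr.
have IS : #|I :&: S| = 1 by apply/eqP; rewrite eqn_leq IS1 card_gt0.
have /eqP/cards2P [y [z [yz SI]]] : #|S :\: I| = 2 by rewrite cardsD setIC IS S3.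
have [ySI zSI] : y \in S :\: I /\ z \in S :\: I by rewrite SI !inE !eqxx orbT.
have [[yS yI] [zS zI]] := (setDP ySI, setDP zSI).
have m_le : (k - #|I|).-1 <= k by rewrite (leq_trans (leq_pred _)) ?leq_subr.
have [|| X0 dX X0k] := far (k - #|I|).-1 set0; rewrite ?cards0 //.
have [|| Y0 dY Y0k] := far (k - #|I|).-1 X0; rewrite ?X0k //.
have notin (X Z : {set 'I_n}) x : [disjoint X & I :|: S :|: Z] -> x \in S -> x \notin X.
  move=> dXZ xS; apply/negP => xX.
  by have := in_set0 x; rewrite -(disj _ _ _ dXZ (sS _)) inE xX xS.
have addI (X Z : {set 'I_n}) x : [disjoint X & I :|: S :|: Z] -> x \notin I ->
    (x |: X) :&: I = set0.
  move=> dXZ xI; rewrite setIUl (disj _ _ _ dXZ (sI _)) setU0.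
  by apply/eqP; rewrite setI_eq0 disjoints1.
have addS x (X : {set 'I_n}) : x \in S -> x \notin I -> 1 < #|((x |: X) :|: I) :&: S|.
  move=> xS xI; apply: (@leq_trans #|x |: (I :&: S)|).
    by rewrite cardsU1 IS (_ : x \notin _) // inE negb_and xI.
  apply/subset_leq_card/subsetP => v /setU1P[->|/setIP[vI vS]].
    by rewrite in_setI xS !in_setU set11.
  by rewrite in_setI vS in_setU vI orbT.
exists (y |: X0), (z |: Y0); split.
- exact: addI dX yI.
- exact: addI dY zI.
- rewrite setIUl !setIUr.
  have -> : [set y] :&: [set z] = set0 by apply/eqP; rewrite setI_eq0 disjoints1 inE.
  have -> : [set y] :&: Y0 = set0 by apply/eqP; rewrite setI_eq0 disjoints1 (notin _ _ _ dY).
  have -> : X0 :&: [set z] = set0.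
    by apply/eqP; rewrite setIC setI_eq0 disjoints1 (notin _ _ _ dX).
  by rewrite (setIC X0) (disj _ _ _ dY (subsetUr _ _)) !setU0.
- by rewrite !cardsU1 X0k Y0k (notin _ _ _ dX yS) (notin _ _ _ dY zS) !add1n prednK ?subn_gt0.
- by split; apply: addS.
Qed.

(** * Bounds on the levels of [Ifam F] and the final comparison *)

Lemma Ifam_top_level (T : finType) (F : {set {set T}}) (k : nat) :
  1 < k -> 50 * k ^ 2 <= #|T| -> uniform k F -> intersecting F ->
  (exists2 S : {set T}, #|S| = 3 & Ifam F \subset hits S k) \/
  25 * #|[set I in Ifam F | #|I| == k.-1]| <= 62 * nsup #|T| k.-1 1.
Proof.
move=> k2 nk Fk Fint; set J := [set _ in _ | _]; pose g d := nsup #|T| k.-1 d.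
have /card_gt0P [x0 _] : 0 < #|T| by nia.
have [P [Q PQ]] := Ifam_petals Fk.
pose a I := odflt x0 [pick x in P I]; pose b I := odflt x0 [pick x in Q I].
have pickE (A : {set T}) : #|A| = 1 -> A = [set odflt x0 [pick x in A]].
  move/eqP/cards1P=> [x ->]; case: pickP => [y|/(_ x)]; rewrite ?inE ?eqxx //.
  by move/eqP->.
have Jab I : I \in J -> [/\ #|I| = k.-1, a I != b I, a I |: I \in F & b I |: I \in F].
  rewrite inE => /andP[/PQ[Pk Qk PQ0 FP FQ] /eqP Ik].
  have PE : P I = [set a I] by apply: pickE; rewrite Pk Ik; lia.
  have QE : Q I = [set b I] by apply: pickE; rewrite Qk Ik; lia.
  rewrite -PE -QE; split=> //; apply/eqP => ab.
  by have := in_set0 (a I); rewrite -PQ0 PE QE ab !inE eqxx.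
have Jk I : I \in J -> #|I| = k.-1 by case/Jab.
(* The threshold [2/25 * g 1] is at least [4 * k * g 2] by [nsupS], so [degree_dichotomy] applies to
   any two points of [H]. *)
pose H := [set p | 2 * g 1 < 25 * #|above J [set p]|].
have cover p q A : p \in H -> q \in H -> p != q -> A \in F -> (p \in A) || (q \in A).
  move=> pH qH pq FA; apply: contraT; rewrite negb_or => /andP[pA qA].
  have := nsupS 1 (ltnW k2) nk; move: pH qH; rewrite !inE -/(g 1) -/(g 2).
  have := degree_dichotomy k2 Fk Fint Jab pq FA pA qA; rewrite -/(g 2).
  by rewrite -[4 * k * _]mulnA -[50 * k * _]mulnA; lia.
have [H2 | /card_gt2P [x [y [z [[xH yH zH] [xy yz zx]]]]]] := leqP #|H| 2; last first.
  left; exists [set x; y; z].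
    by rewrite setUC cardsU1 cards2 !inE xy (negPf zx) eq_sym (negPf yz).
  apply/subsetP => I FI; rewrite inE (card_Ifam_lt Fk FI) /=.
  case/IfamP: FI => [A [B [FA FB _ ->]]]; apply/meetP.
  (* Each of [A] and [B] contains two of the three points, so they share one. *)
  move: (cover _ _ _ xH yH xy FA) (cover _ _ _ yH zH yz FA) (cover _ _ _ zH xH zx FA).
  move: (cover _ _ _ xH yH xy FB) (cover _ _ _ yH zH yz FB) (cover _ _ _ zH xH zx FB).
  case xA: (x \in A); case yA: (y \in A); case zA: (z \in A) => //;
    case xB: (x \in B); case yB: (y \in B); case zB: (z \in B) => // *;
  by [exists x; rewrite !inE ?xA ?xB ?eqxx | exists y; rewrite !inE ?yA ?yB ?eqxx ?orbT
     | exists z; rewrite !inE ?zA ?zB ?eqxx ?orbT].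
(* Discarding the members that meet [H] leaves a sparse family, as points of [H] get degree zero.
   The discarded ones number at most [2 * g 1], whence [62 = 12 + 2 * 25]. *)
right; pose J' := [set I in J | I :&: H == set0].
have J'J : J' \subset J by apply/subsetP => I; rewrite inE => /andP[].
have J'_le : 25 * #|J'| <= 12 * g 1.
  apply: (sparse_conflicting k2 nk Fk Fint (a := a) (b := b)).
    by move=> I /(subsetP J'J)/Jab.
  move=> p; case: (boolP (p \in H)) => pH.
    rewrite (_ : above _ _ = set0) ?cards0 ?muln0 //; apply/setP => I.
    rewrite !inE sub1set; apply/negP => /andP[/andP[_ /eqP IH] pI].
    by have := in_set0 p; rewrite -IH inE pI pH.
  move: pH; rewrite inE -leqNgt; apply: leq_trans.
  by rewrite leq_mul2l subset_leq_card // aboveS.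
have : #|J| <= #|[set I in above J set0 | I :&: H != set0]| + #|J'|.
  apply: card_le_setU => I JI; have [IH|IH] := eqVneq (I :&: H) set0.
    by right; apply/setIdP; rewrite IH.
  by left; apply/setIdP; split=> //; apply/setIdP; rewrite sub0set.
have : #|[set I in above J set0 | I :&: H != set0]| <= #|H| * g 1.
  apply: card_above_meet => p _; rewrite setU0.
  by have := card_above [set p] Jk; rewrite cards1.
have : #|H| * g 1 <= 2 * g 1 by rewrite leq_mul2r H2 orbT.
by move: J'_le; rewrite -/(g 1); lia.
Qed.

Lemma Ifam_second_level (T : finType) (F : {set {set T}}) (k : nat) :
  1 < k -> uniform k F -> intersecting F ->
  #|[set I in Ifam F | #|I| == k.-2]| <= 5 * k * nsup #|T| k.-2 1.
Proof.
move=> k2 Fk Fint; have [P [Q PQ]] := Ifam_petals Fk.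
have -> : 5 * k = 5 * k.-2 + 8 + 2 by lia.
rewrite mulnDl; apply: leq_trans (leq_addr _ _).
apply: (card_pair_conflict (P := P) (Q := Q) Fint).
  move=> I; rewrite inE => /andP[/PQ[Pk Qk PQ0 FP FQ] /eqP Ik].
  by rewrite Pk Qk Ik; split=> //; lia.
move=> p; rewrite -[1](cards1 p); apply: card_above => I.
by rewrite inE => /andP[_ /eqP].
Qed.

Theorem theorem1p4 (k n : nat) (F : {set {set 'I_n}}) :
  2 <= k -> 50 * k ^ 2 <= n ->
  uniform k F -> intersecting F ->
  #|Ifam F| <= #|Ifam (Afam n k)|.
Proof.
move=> k2 nk Fk Fint; apply: leq_trans (subset_leq_card (hits_sub_Ifam k2 nk)).
have n3 : 2 < n by nia.
have S3 := card_first3 n3; set S := first3 n in S3 *.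
have nT : 50 * k ^ 2 <= #|'I_n| by rewrite card_ord.
have [[S' S'3 FS']|top] := Ifam_top_level k2 nT Fk Fint.
  apply: leq_trans (subset_leq_card FS') _.
  have := card_hits S' k; have := card_hits S k; rewrite S3 S'3.
  by move=> <- /addIn->.
have E l d : nsup n l d = nsup #|'I_n| l d by rewrite card_ord.
pose g1 := nsup n k.-1 1; pose g2 := nsup n k.-1 2; pose h1 := nsup n k.-2 1.
pose J := [set I in Ifam F | #|I| == k.-1].
pose K := [set I in Ifam F | #|I| == k.-2].
pose L := [set I : {set 'I_n} | #|I| < k.-2].
have J_le : 25 * #|J| <= 62 * g1 by rewrite /g1 E.
have K_le : #|K| <= 5 * k * h1.
  by rewrite /h1 E; apply: Ifam_second_level.
have L_le : #|L| <= 4 * h1 by rewrite /h1 E; apply: card_small_sets.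
have lower : 3 * g1 <= #|hits S k| + 3 * g2.
  by rewrite /g1 /g2 !E; apply: card_hits_ge => //; rewrite card_ord; nia.
have g12 : 50 * k * g2 <= g1 := nsupS 1 (ltnW k2) nk.
have g1h : 50 * k * h1 <= g1 := nsup_pred k2 nk.
have split_le : #|Ifam F| <= #|J| + #|K :|: L|.
  apply: card_le_setU => I FI; have Ik := card_Ifam_lt Fk FI.
  have [Ik1|Ik1] := eqVneq #|I| k.-1; first by left; rewrite inE FI Ik1 eqxx.
  have Ik2 : #|I| < k.-1 by rewrite ltn_neqAle Ik1 -ltnS prednK // ltnW.
  by right; rewrite !inE FI /= -leq_eqVlt; move: #|I| Ik2 => i; clear; lia.
have [KL _] := leq_card_setU K L.
(* Since [k >= 2], both [g2] and [h1] are at most [g1 / 100]. The upper bound is then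
   [(2.48 + 0.1 + 0.04) * g1], below the lower bound [(3 - 0.03) * g1]. *)
have kg2 : 100 * g2 <= 50 * k * g2 by rewrite leq_mul2r; lia.
have kh1 : 100 * h1 <= 50 * k * h1 by rewrite leq_mul2r; lia.
rewrite -mulnA in K_le; rewrite -mulnA in g1h; rewrite -mulnA in kh1.
move: J_le K_le L_le lower g12 g1h split_le KL kg2 kh1; clear.
move: #|Ifam F| #|hits S k| #|J| #|K| #|L| #|K :|: L| h1 g1 g2 (k * h1) (50 * k * g2).
lia.
Qed.
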